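(* Let $G$ be a Dyck graph on $\{1,\dots,n\}$ and, for $1\le j\le n$, let $a_j$ be the number of edges $\{i,j\}$ of $G$ with $i<j$. Then $$(t-1)^n\,X_G\left(\frac{q-1}{t-1}\right)=\prod_{j=1}^n(q-t^{a_j}).$$
   Context: A Dyck graph is a simple graph on $\{1,\dots,n\}$ such that whenever $\{i,j\}$ with $i<j$ is an edge, all $\{i',j'\}$ with $i\le i'<j'\le j$ are edges. The chromatic quasi-symmetric function of $G$ is $X_G=\sum_{c}t^{\mathrm{asc}_G(c)}x_{c(1)}\cdots x_{c(n)}$, the sum being over all proper colorings $c:\{1,\dots,n\}\to\{1,2,3,\dots\}$ of $G$, where $\mathrm{asc}_G(c)$ is the number of edges $\{i,j\}$ with $i<j$ and $c(i)<c(j)$. For a Dyck graph it is known to be a symmetric function of $X=(x_1,x_2,\dots)$ with coefficients in $\mathbb{Z}[t]$. For a symmetric function $f$, $f\left(\frac{q-1}{t-1}\right)$ denotes the image of $f$ under the morphism of $\mathbb{Q}(q,t)$-algebras sending each power sum $p_k$ to $\frac{q^k-1}{t^k-1}$. *)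

(* Defs.v *)
From HB Require Import structures.
From mathcomp Require Import all_boot all_order all_algebra.
From mathcomp Require Import perm boolp.
From mathcomp Require Import mpoly.

Set Implicit Arguments.
Unset Strict Implicit.
Unset Printing Implicit Defensive.

Import GRing.Theory.
Local Open Scope ring_scope.

(* The ring of symmetric functions is the graded inverse limit of the rings   *)
(* of symmetric polynomials (Macdonald, Symmetric Functions and Hall          *)
(* Polynomials, I.2): a power series of bounded degree f(x_0, x_1, ...) is    *)
(* given by its truncations f N = f(x_0, ..., x_(N-1), 0, 0, ...).            *)

Definition xfamily (R : comNzRingType) := forall N, {mpoly R[N]}.

Section FamilyAlgebra.
Variable R : comNzRingType.
Implicit Types (a b : R) (f g h : xfamily R).

HB.instance Definition _ := gen_eqMixin (xfamily R).
HB.instance Definition _ := gen_choiceMixin (xfamily R).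

Definition xfamily_zero : xfamily R := fun N => 0.
Definition xfamily_one : xfamily R := fun N => 1.
Definition xfamily_opp f : xfamily R := fun N => - f N.
Definition xfamily_add f g : xfamily R := fun N => f N + g N.
Definition xfamily_mul f g : xfamily R := fun N => f N * g N.
Definition xfamily_scale a f : xfamily R := fun N => a *: f N.

Lemma xfamilyP f g : (forall N, f N = g N) -> f = g.
Proof. exact: functional_extensionality_dep. Qed.

Fact xfamily_addA : associative xfamily_add.
Proof. by move=> f g h; apply: xfamilyP => N; apply: addrA. Qed.
Fact xfamily_addC : commutative xfamily_add.
Proof. by move=> f g; apply: xfamilyP => N; apply: addrC. Qed.
Fact xfamily_add0 : left_id xfamily_zero xfamily_add.
Proof. by move=> f; apply: xfamilyP => N; apply: add0r. Qed.
Fact xfamily_addN : left_inverse xfamily_zero xfamily_opp xfamily_add.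
Proof. by move=> f; apply: xfamilyP => N; apply: addNr. Qed.
HB.instance Definition _ := GRing.isZmodule.Build (xfamily R)
  xfamily_addA xfamily_addC xfamily_add0 xfamily_addN.

Fact xfamily_mulA : associative xfamily_mul.
Proof. by move=> f g h; apply: xfamilyP => N; apply: mulrA. Qed.
Fact xfamily_mulC : commutative xfamily_mul.
Proof. by move=> f g; apply: xfamilyP => N; apply: mulrC. Qed.
Fact xfamily_mul1 : left_id xfamily_one xfamily_mul.
Proof. by move=> f; apply: xfamilyP => N; apply: mul1r. Qed.
Fact xfamily_mulD : left_distributive xfamily_mul +%R.
Proof. by move=> f g h; apply: xfamilyP => N; apply: mulrDl. Qed.
Fact xfamily_one_neq0 : xfamily_one != 0.
Proof.
by apply/eqP => /(congr1 (fun f : xfamily R => f 0%N)) /eqP; rewrite oner_eq0.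
Qed.
HB.instance Definition _ := GRing.Zmodule_isComNzRing.Build (xfamily R)
  xfamily_mulA xfamily_mulC xfamily_mul1 xfamily_mulD xfamily_one_neq0.

Fact xfamily_scaleA a b f :
  xfamily_scale a (xfamily_scale b f) = xfamily_scale (a * b) f.
Proof. by apply: xfamilyP => N; apply: scalerA. Qed.
Fact xfamily_scale1 : left_id 1 xfamily_scale.
Proof. by move=> f; apply: xfamilyP => N; apply: scale1r. Qed.
Fact xfamily_scaleDr : right_distributive xfamily_scale +%R.
Proof. by move=> a f g; apply: xfamilyP => N; apply: scalerDr. Qed.
Fact xfamily_scaleDl f : {morph xfamily_scale^~ f : a b / a + b}.
Proof. by move=> a b; apply: xfamilyP => N; apply: scalerDl. Qed.
HB.instance Definition _ := GRing.Zmodule_isLmodule.Build R (xfamily R)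
  xfamily_scaleA xfamily_scale1 xfamily_scaleDr xfamily_scaleDl.

Fact xfamily_scaleAl a f g : a *: (f * g) = (a *: f) * g.
Proof. by apply: xfamilyP => N; apply: scalerAl. Qed.
HB.instance Definition _ :=
  GRing.Lmodule_isLalgebra.Build R (xfamily R) xfamily_scaleAl.
HB.instance Definition _ :=
  GRing.Lalgebra_isComAlgebra.Build R (xfamily R).

End FamilyAlgebra.

Definition kill_last (R : comNzRingType) N (p : {mpoly R[N.+1]}) :
  {mpoly R[N]} :=
  p \mPo [tuple if unlift ord_max i is Some j then 'X_j else 0 | i < N.+1].

Definition is_symfun (R : comNzRingType) (f : xfamily R) : Prop :=
  [/\ forall N, f N \is symmetric,
      forall N, kill_last (f N.+1) = f N
    & exists d, forall N, (msize (f N) <= d)%N].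

Definition symfun_pred (R : comNzRingType) : {pred xfamily R} :=
  fun f => `[< is_symfun f >].

Lemma symfun_predP (R : comNzRingType) (f : xfamily R) :
  reflect (is_symfun f) (f \in @symfun_pred R).
Proof. exact: asboolP. Qed.

Record symfun (R : comNzRingType) :=
  SymFun { symfun_val : xfamily R; _ : symfun_val \in @symfun_pred R }.

Section SymFunAlgebra.
Variable R : comNzRingType.

HB.instance Definition _ := [isSub of symfun R for @symfun_val R].
HB.instance Definition _ := [Choice of symfun R by <:].

Fact symfun_subalg_closed : subalg_closed (@symfun_pred R).
Proof.
split.
- apply/symfun_predP; split=> [N|N|]; first exact: rpred1.
    by rewrite /kill_last rmorph1.
  by exists 1%N => N; rewrite msize1.
- move=> a f g /symfun_predP[fS fK [d fd]] /symfun_predP[gS gK [e ge]].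
  apply/symfun_predP; split=> [N|N|].
  + exact: (rpredD (rpredZ a (fS N)) (gS N)).
  + have -> : (a *: f + g) N = a *: f N + g N by [].
    by rewrite -fK -gK /kill_last -linearP.
  + exists (maxn d e) => N; apply: leq_trans (msizeD_le _ _) _.
    rewrite geq_max !leq_max (leq_trans (msizeZ_le _ _) (fd N)).
    by rewrite ge orbT.
- move=> f g /symfun_predP[fS fK [d fd]] /symfun_predP[gS gK [e ge]].
  apply/symfun_predP; split=> [N|N|].
  + exact: rpredM (fS N) (gS N).
  + have -> : (f * g) N = f N * g N by [].
    by rewrite -fK -gK /kill_last -rmorphM.
  + exists (d + e).+1%N => N; apply: leq_trans (msizeM_le _ _) _.
    by rewrite ltnS leq_add.
Qed.
HB.instance Definition _ :=
  GRing.isSubalgClosed.Build R (xfamily R) (@symfun_pred R)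
    symfun_subalg_closed.
HB.instance Definition _ := [SubChoice_isSubAlgebra of symfun R by <:].
HB.instance Definition _ := [SubNzRing_isSubComNzRing of symfun R by <:].

End SymFunAlgebra.

(* A power series that is not symmetric is sent to the junk value 0. *)
Definition to_symfun (R : comNzRingType) (f : xfamily R) : symfun R :=
  insubd (0 : symfun R) f.

Lemma to_symfunK (R : comNzRingType) (f : xfamily R) :
  is_symfun f -> symfun_val (to_symfun f) = f.
Proof. by move=> /symfun_predP fS; rewrite insubdK. Qed.

Definition powersum_family (R : comNzRingType) (k : nat) : xfamily R :=
  fun N => \sum_(i < N) 'X_i ^+ k.

(* p_k is a symmetric function for k > 0 only: p_0 would be the number of     *)
(* variables.                                                                 *)
Definition powersum (R : comNzRingType) (k : nat) : symfun R :=
  to_symfun (powersum_family R k).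

Lemma powersum_is_symfun (R : comNzRingType) (k : nat) :
  (0 < k)%N -> is_symfun (powersum_family R k).
Proof.
move=> k_gt0; split=> [N|N|].
- apply/issymP => s; rewrite /powersum_family rmorph_sum /=.
  rewrite [RHS](reindex_inj (@perm_inj _ s)) /=; apply: eq_bigr => i _.
  rewrite rmorphXn /= /msym mmapX mmap1U; congr (_ ^+ _).
- rewrite /kill_last /powersum_family rmorph_sum /= big_ord_recr /=.
  rewrite rmorphXn /= comp_mpolyXU -tnth_nth tnth_mktuple unlift_none.
  rewrite expr0n eqn0Ngt k_gt0 addr0; apply: eq_bigr => i _.
  rewrite rmorphXn /= comp_mpolyXU -tnth_nth tnth_mktuple.
  have -> : widen_ord (leqnSn N) i = lift ord_max i.
    by apply: val_inj; rewrite /= /bump leqNgt ltn_ord.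
  by rewrite liftK.
- exists k.+1 => N; rewrite /powersum_family.
  apply: leq_trans (mmeasure_sum _ _ _ _) _.
  apply/bigmax_leqP => i _.
  by rewrite mpolyXn msizeX mdegMn mdeg1 mul1n.
Qed.

Lemma powersumE (R : comNzRingType) (k : nat) :
  (0 < k)%N -> symfun_val (powersum R k) = powersum_family R k.
Proof. by move=> k_gt0; apply/to_symfunK/powersum_is_symfun. Qed.

(* Vertices and variables are numbered from 0. *)
Section DyckGraphs.
Variable n : nat.
Implicit Type E : rel 'I_n.

Definition simple_graph E := ssrbool.symmetric E /\ irreflexive E.

Definition dyck_graph E := simple_graph E /\
  forall i j : 'I_n, (i < j)%N -> E i j ->
  forall i' j' : 'I_n, (i <= i')%N -> (i' < j')%N -> (j' <= j)%N -> E i' j'.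

Definition proper_coloring E N (c : {ffun 'I_n -> 'I_N}) : bool :=
  [forall i, forall j, E i j ==> (c i != c j)].

Definition asc E N (c : {ffun 'I_n -> 'I_N}) : nat :=
  #|[set e : 'I_n * 'I_n | [&& (e.1 < e.2)%N, E e.1 e.2 & (c e.1 < c e.2)%N]]|.

(* The truncation to N variables keeps the colorings with colors < N. *)
Definition chromatic_family (R : comNzRingType) (t : R) E : xfamily R :=
  fun N => \sum_(c : {ffun 'I_n -> 'I_N} | proper_coloring E c)
             t ^+ asc E c *: \prod_(i < n) 'X_(c i).

Definition chromatic_symfun (R : comNzRingType) (t : R) E : symfun R :=
  to_symfun (chromatic_family t E).

Definition left_degree E (j : 'I_n) : nat :=
  #|[set i : 'I_n | (i < j)%N && E i j]|.

End DyckGraphs.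

(* Q(q,t) is the fraction field of Q[t][q]. *)
Definition Qqt : fieldType := {fraction {poly {poly rat}}}.

Definition qvar : Qqt := tofrac 'X.
Definition tvar : Qqt := tofrac ('X%:P).

(* Main.v *)
(* Power sums generate the symmetric functions in characteristic 0, so        *)
(* phi X_G is the value at q of a polynomial h over Q(q,t) whose value at t^m *)
(* is X_G(t^(m-1), ..., t, 1), for every m.  This principal specialization is *)
(* computed by adding the vertices in increasing order: the neighbours of the *)
(* new vertex j form a clique, hence have a_j distinct colors, and the sum    *)
(* over the colors left for j telescopes to (t^m - t^(a_j)) / (t - 1).  Thus  *)
(* (t - 1)^n h and the product of the q - t^(a_j) agree at all powers of t,   *)
(* so they are equal.  That X_G is symmetric is proved one pair of adjacent   *)
(* colors at a time.                                                          *)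

Require Import Defs.
From mathcomp Require Import all_boot all_order all_algebra.
From mathcomp Require Import perm boolp mpoly ring.

Set Implicit Arguments.
Unset Strict Implicit.
Unset Printing Implicit Defensive.

Import GRing.Theory.
Local Open Scope ring_scope.

(** At [q = t^m] the prescribed image of [p_k] is [1 + t^k + ... + t^((m-1)k)], the power sum of
    [t^(m-1), ..., t, 1]. Since the power sums generate ([symfun_ind]), [phi f] is the value at [q]
    of a polynomial that interpolates the principal specializations of [f]
    ([symfun_specialization]); as [t] is not a root of unity, they determine this polynomial
    ([poly_eq_on_powers]).

    For [X_G] the specialization to [m] variables is a sum over colorings, weighted edge by edge.
    The neighbours of the last vertex form a clique, so a proper coloring gives them distinct
    colors, and the choice of the last color contributes [(t^m - t^a) / (t - 1)], with [a] the
    number of neighbours, whatever their colors are ([sum_free_colors], [coloring_sum_principal]).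

    Symmetry is what keeps [chromatic_symfun] from being the default 0. The exchange of two
    consecutive colors is studied on each set of colorings that agree up to these two colors
    ([fiber_sum_transfer]). *)

(** * Adding a last vertex to a coloring *)

Section FunctionExtension.
Variables (n : nat) (T : finType).

Definition ffun_rcons (c : {ffun 'I_n -> T}) (k : T) : {ffun 'I_n.+1 -> T} :=
  [ffun i => if unlift ord_max i is Some j then c j else k].

Lemma ffun_rcons_lift c k i : ffun_rcons c k (lift ord_max i) = c i.
Proof. by rewrite ffunE liftK. Qed.

Lemma ffun_rcons_max c k : ffun_rcons c k ord_max = k.
Proof. by rewrite ffunE unlift_none. Qed.

Lemma widen_ord_lift (i : 'I_n) : widen_ord (leqnSn n) i = lift ord_max i.
Proof. by apply: val_inj; rewrite /= /bump leqNgt ltn_ord. Qed.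

Lemma big_ffun_rcons (R : nmodType) (P : pred {ffun 'I_n.+1 -> T}) F :
  \sum_(c : {ffun 'I_n.+1 -> T} | P c) F c =
  \sum_(c : {ffun 'I_n -> T}) \sum_(k | P (ffun_rcons c k)) F (ffun_rcons c k) :> R.
Proof.
rewrite pair_big_dep /=.
rewrite (reindex (fun p : {ffun 'I_n -> T} * T => ffun_rcons p.1 p.2)) //=.
exists (fun c => ([ffun i => c (lift ord_max i)], c ord_max)) => [[c k] _|c _] /=.
  rewrite ffun_rcons_max; congr pair; apply/ffunP => i.
  by rewrite ffunE ffun_rcons_lift.
by apply/ffunP => i; rewrite ffunE; case: unliftP => [j|] ->; rewrite ?ffunE.
Qed.

End FunctionExtension.

Lemma prod_ord_rcons (R : comPzRingType) n (F : 'I_n.+1 -> R) :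
  \prod_(i < n.+1) F i = (\prod_(i < n) F (lift ord_max i)) * F ord_max.
Proof.
by rewrite big_ord_recr /=; under eq_bigr do rewrite widen_ord_lift.
Qed.

Definition del_last n (E : rel 'I_n.+1) : rel 'I_n :=
  fun i j => E (lift ord_max i) (lift ord_max j).

Definition interval_closed n (E : rel 'I_n) :=
  forall i j : 'I_n, (i < j)%N -> E i j ->
  forall i' j' : 'I_n, (i <= i')%N -> (i' < j')%N -> (j' <= j)%N -> E i' j'.

Lemma del_last_closed n (E : rel 'I_n.+1) :
  interval_closed E -> interval_closed (del_last E).
Proof.
move=> EI i j ij Eij i' j' ii' i'j' j'j.
by apply: (EI _ _ _ Eij); rewrite !lift_max.
Qed.

(** * Coloring sums as products of edge weights *)

Section ColoringSums.
Variables (R : comNzRingType) (t : R).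

(** Weight of an edge whose lower end has color [k] and upper end color [l]: the value 0 encodes
    properness, [t] records an ascent. *)
Definition edge_weight (k l : nat) : R :=
  if k == l then 0 else if (k < l)%N then t else 1.

Definition back_weight n N (E : rel 'I_n) (c : 'I_n -> 'I_N) (j : 'I_n) : R :=
  \prod_(i < n | (i < j)%N && E i j) edge_weight (c i) (c j).

Definition coloring_weight n N (X : 'I_N -> R) (E : rel 'I_n)
    (c : 'I_n -> 'I_N) : R :=
  \prod_(j < n) (X (c j) * back_weight E c j).

Definition coloring_sum n N (X : 'I_N -> R) (E : rel 'I_n) : R :=
  \sum_(c : {ffun 'I_n -> 'I_N}) coloring_weight X E c.

Definition last_weight n N (E : rel 'I_n.+1) (c : 'I_n -> 'I_N) (k : 'I_N) : R :=
  \prod_(i < n | E (lift ord_max i) ord_max) edge_weight (c i) k.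

Lemma coloring_weight_rcons n N (X : 'I_N -> R) (E : rel 'I_n.+1)
    (c : {ffun 'I_n -> 'I_N}) k :
  coloring_weight X E (ffun_rcons c k) =
  coloring_weight X (del_last E) c * (X k * last_weight E c k).
Proof.
rewrite /coloring_weight prod_ord_rcons ffun_rcons_max; congr (_ * (_ * _)).
  apply: eq_bigr => j _; rewrite ffun_rcons_lift; congr (_ * _).
  rewrite /back_weight big_mkcond prod_ord_rcons lift_max ltnNge (ltnW (ltn_ord j)) andFb mulr1 [RHS]big_mkcond; apply: eq_bigr => i _.
  by rewrite !lift_max !ffun_rcons_lift.
rewrite /back_weight big_mkcond prod_ord_rcons ltnn andFb mulr1.
rewrite /last_weight [RHS]big_mkcond; apply: eq_bigr => i _.
by rewrite ffun_rcons_lift ffun_rcons_max lift_max ltn_ord.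
Qed.

Lemma coloring_weight_eq0 n N (X : 'I_N -> R) (E : rel 'I_n) (c : 'I_n -> 'I_N)
    (i j : 'I_n) :
  (i < j)%N -> E i j -> c i = c j -> coloring_weight X E c = 0.
Proof.
move=> ij Eij cij; rewrite /coloring_weight (bigD1 j) //= /back_weight.
by rewrite (bigD1 i) ?ij //= cij {1}/edge_weight eqxx mul0r mulr0 mul0r.
Qed.

End ColoringSums.

(** Serves both to set the last variable to 0 and to evaluate at powers of [t]. *)
Lemma coloring_sum_morph (R S : comNzRingType) (f : {rmorphism R -> S})
    (t : R) n N (X : 'I_N -> R) (E : rel 'I_n) :
  f (coloring_sum t X E) = coloring_sum (f t) (fun k => f (X k)) E.
Proof.
rewrite rmorph_sum; apply: eq_bigr => c _; rewrite rmorph_prod.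
apply: eq_bigr => j _; rewrite rmorphM /back_weight rmorph_prod.
by congr (_ * _); apply: eq_bigr => i _; rewrite /edge_weight; do 2?case: ifP;
   rewrite ?rmorph0 ?rmorph1.
Qed.

Lemma eq_coloring_sum (R : comNzRingType) (t : R) n N (X Y : 'I_N -> R)
    (E : rel 'I_n) :
  X =1 Y -> coloring_sum t X E = coloring_sum t Y E.
Proof.
move=> XY; apply: eq_bigr => c _.
by apply: eq_bigr => j _; rewrite XY.
Qed.

Lemma chromatic_familyE (R : comNzRingType) (t : R) n (E : rel 'I_n) N :
  ssrbool.symmetric E -> irreflexive E ->
  chromatic_family t E N =
  coloring_sum t%:MP (fun k => 'X_k : {mpoly R[N]}) E.
Proof.
move=> Esym Eirr; rewrite /chromatic_family big_mkcond; apply: eq_bigr => c _.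
rewrite /coloring_weight big_split /= mulrC -mul_mpolyC.
case: ifP => [/forallP proper_c|/negbT].
  (* The power of [t] is written as a product over pairs of vertices, to be matched factor by factor
     with the edge weights. *)
  congr (_ * _); rewrite rmorphXn /= /asc -prodr_const.
  rewrite /back_weight pair_big_dep_idem /=; last exact: mulr1.
  rewrite (reindex (fun p : 'I_n * 'I_n => (p.2, p.1))) /=; last first.
    by exists (fun p => (p.2, p.1)) => [[]|[]].
  rewrite big_mkcond [RHS]big_mkcond; apply: eq_bigr => -[i j] _ /=.
  rewrite inE /=; case: ifP => [/and3P[ij Eij cij]|].
    by rewrite ij Eij /= /edge_weight cij ltn_eqF.
  case: ifP => // /andP[-> Eij] /=; rewrite Eij /= /edge_weight => ->.
  have /forallP/(_ i)/implyP/(_ Eij)/negPf := proper_c j.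
  by rewrite -val_eqE /= => ->.
rewrite negb_forall => /existsP[i]; rewrite negb_forall => /existsP[j].
rewrite negb_imply negbK => /andP[Eij /eqP cij].
wlog ij : i j Eij cij / (i < j)%N => [IH|].
  case: (ltngtP i j) => [|ji|/val_inj eij]; first exact: IH.
    by apply: (IH j i) => //; rewrite Esym.
  by rewrite eij Eirr in Eij.
have := @coloring_weight_eq0 _ t%:MP _ _ (fun k => 'X_k : {mpoly R[N]}) E c i j ij Eij cij.
by rewrite /coloring_weight big_split /= mulrC.
Qed.
Lemma ffun_rcons_restrict n (T : finType) (c : {ffun 'I_n.+1 -> T}) :
  ffun_rcons [ffun i => c (lift ord_max i)] (c ord_max) = c.
Proof.
by apply/ffunP => i; rewrite ffunE; case: unliftP => [j|] ->; rewrite ?ffunE.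
Qed.

Lemma eq_ffun_rcons n (T : finType) (c c' : {ffun 'I_n -> T}) k k' :
  (ffun_rcons c k == ffun_rcons c' k') = (c == c') && (k == k').
Proof.
apply/eqP/andP => [e|[/eqP-> /eqP->]//]; split; apply/eqP.
  by apply/ffunP => i; rewrite -(ffun_rcons_lift c k) e ffun_rcons_lift.
by rewrite -(ffun_rcons_max c k) e ffun_rcons_max.
Qed.

(** * Invariance under the exchange of two consecutive colors *)

Section AdjacentColors.
Variables (R : comNzRingType) (t : R) (N : nat) (X : 'I_N -> R) (a b : 'I_N).
Hypothesis ab : b = a.+1 :> nat.
(** Stands for the exchange of the variables of [a] and [b]. *)
Variable tau : {rmorphism R -> R}.
Hypothesis tau_t : tau t = t.
Hypothesis tau_X : forall k, tau (X k) = X (tperm a b k).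

Let neq_ab : (a == b) = false.
Proof. by rewrite -val_eqE /= ab ltn_eqF. Qed.

Let neq_ba : (b == a) = false.
Proof. by rewrite eq_sym. Qed.

(** A fiber of the induced map on colorings consists of all ways to color with [a] or [b] a fixed
    set of vertices, the other colors being fixed. *)
Definition merge_color (k : 'I_N) : 'I_N := if k == b then a else k.

Definition merge_coloring n (c : {ffun 'I_n -> 'I_N}) : {ffun 'I_n -> 'I_N} :=
  [ffun i => merge_color (c i)].

Lemma merge_coloring_rcons n (c : {ffun 'I_n -> 'I_N}) k :
  merge_coloring (ffun_rcons c k) = ffun_rcons (merge_coloring c) (merge_color k).
Proof. by apply/ffunP => i; rewrite !ffunE; case: unlift => //= j; rewrite ffunE. Qed.

Lemma merge_color_neq k : (merge_color k == b) = false.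
Proof. by rewrite /merge_color; case: ifP => // _; rewrite neq_ab. Qed.

Lemma merge_color_id k : k != b -> merge_color k = k.
Proof. by rewrite /merge_color => /negPf->. Qed.

Lemma merge_color_eqa k : (merge_color k == a) = (k == a) || (k == b).
Proof. by rewrite /merge_color; case: ifP => _; rewrite ?eqxx ?orbT ?orbF. Qed.

Lemma merge_color_eq k l : l != a -> l != b -> (merge_color k == l) = (k == l).
Proof.
move=> la lb; rewrite /merge_color; case: (eqVneq k b) => // ->.
by rewrite ![_ == l]eq_sym (negPf la) (negPf lb).
Qed.

(** No color lies strictly between [a] and [b = a + 1], so a third color compares in the same way
    with both. *)
Lemma edge_merge (k l : 'I_N) : l != a -> l != b ->
  edge_weight t k l = edge_weight t (merge_color k) l.
Proof.
rewrite /merge_color; case: (eqVneq k b) => // -> la lb.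
rewrite /edge_weight ab; rewrite -val_eqE /= in la; rewrite -val_eqE /= ab in lb.
by rewrite [_ == l :> nat]eq_sym (negPf lb) [_ == l :> nat]eq_sym (negPf la)
  [in RHS]leq_eqVlt [_ == l :> nat]eq_sym (negPf lb).
Qed.

Lemma edge_adjacent (k l : 'I_N) : l \in [:: a; b] -> merge_color k != a ->
  edge_weight t k l = edge_weight t (merge_color k) a.
Proof.
rewrite !inE merge_color_eqa negb_or => + /andP[ka kb]; rewrite merge_color_id //.
case/orP => /eqP-> //; rewrite -val_eqE /= in ka; rewrite -val_eqE /= ab in kb.
rewrite /edge_weight ab (negPf ka) (negPf kb).
by rewrite ltnS leq_eqVlt (negPf ka).
Qed.

Lemma tau_edge k l : tau (edge_weight t k l) = edge_weight t k l.
Proof. by rewrite /edge_weight; do 2?case: ifP; rewrite ?rmorph0 ?rmorph1. Qed.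

Definition fiber_sum n (E : rel 'I_n) (d : {ffun 'I_n -> 'I_N}) : R :=
  \sum_(c | merge_coloring c == d) coloring_weight t X E c.

Definition fiber_sum_at n (E : rel 'I_n) (d : {ffun 'I_n -> 'I_N}) j k : R :=
  \sum_(c | (merge_coloring c == d) && (c j == k)) coloring_weight t X E c.

Lemma fiber_sum_rcons n (E : rel 'I_n.+1) (d : {ffun 'I_n -> 'I_N}) l :
  fiber_sum E (ffun_rcons d l) =
  \sum_(c | merge_coloring c == d) \sum_(k | merge_color k == l)
    coloring_weight t X (del_last E) c * (X k * last_weight t E c k).
Proof.
rewrite /fiber_sum big_ffun_rcons [RHS]big_mkcond; apply: eq_bigr => c _.
under eq_bigl do rewrite merge_coloring_rcons eq_ffun_rcons.
case: eqP => _ /=; last by rewrite big_pred0.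
by apply: eq_bigr => k _; rewrite coloring_weight_rcons.
Qed.

Lemma fiber_sum_at_lift n (E : rel 'I_n.+1) (d : {ffun 'I_n -> 'I_N}) l j k0 :
  fiber_sum_at E (ffun_rcons d l) (lift ord_max j) k0 =
  \sum_(c | (merge_coloring c == d) && (c j == k0)) \sum_(k | merge_color k == l)
    coloring_weight t X (del_last E) c * (X k * last_weight t E c k).
Proof.
rewrite /fiber_sum_at big_ffun_rcons [RHS]big_mkcond; apply: eq_bigr => c _.
under eq_bigl do rewrite merge_coloring_rcons eq_ffun_rcons ffun_rcons_lift.
case: eqP => _ /=; last by rewrite big_pred0.
case: eqP => _ /=; last by rewrite big_pred0 // => k; rewrite andbF.
by under eq_bigl do rewrite andbT; apply: eq_bigr => k _; rewrite coloring_weight_rcons.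
Qed.

Lemma fiber_sum_at_max n (E : rel 'I_n.+1) (d : {ffun 'I_n -> 'I_N}) l k :
  merge_color k = l ->
  fiber_sum_at E (ffun_rcons d l) ord_max k =
  X k * \sum_(c | merge_coloring c == d)
    coloring_weight t X (del_last E) c * last_weight t E c k.
Proof.
move=> kl; rewrite /fiber_sum_at big_ffun_rcons [in RHS]big_mkcond mulr_sumr.
apply: eq_bigr => c _.
under eq_bigl do rewrite merge_coloring_rcons eq_ffun_rcons ffun_rcons_max.
case: eqP => _ /=; last by rewrite big_pred0 // mulr0.
rewrite (big_pred1 k) ?coloring_weight_rcons 1?mulrCA // => k' /=.
by case: (eqVneq k' k) => [->|_]; rewrite ?kl ?eqxx ?andbF.
Qed.

Lemma fiber_sum_split n (d : {ffun 'I_n -> 'I_N}) j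
    (F : {ffun 'I_n -> 'I_N} -> R) : d j = a ->
  \sum_(c | merge_coloring c == d) F c =
  \sum_(c | (merge_coloring c == d) && (c j == a)) F c +
  \sum_(c | (merge_coloring c == d) && (c j == b)) F c.
Proof.
move=> dj; rewrite (bigID (fun c : {ffun 'I_n -> 'I_N} => c j == a)) /=.
congr (_ + _); apply: eq_bigl => c; case: eqP => //= /ffunP/(_ j).
rewrite ffunE dj => /eqP; rewrite merge_color_eqa => /orP[] /eqP->.
  by rewrite eqxx neq_ab.
by rewrite eqxx neq_ba.
Qed.

(** The weight of the last vertex, when colored [a] or [b], splits into this factor, constant on the
    fiber of [d], and [inner_weight], which comes from the neighbours colored [a] or [b]. *)
Definition outer_weight n (E : rel 'I_n.+1) (d : {ffun 'I_n -> 'I_N}) : R :=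
  \prod_(i < n | E (lift ord_max i) ord_max && (d i != a)) edge_weight t (d i) a.

Definition inner_weight n (E : rel 'I_n.+1) (d c : {ffun 'I_n -> 'I_N}) k : R :=
  \prod_(i < n | E (lift ord_max i) ord_max && (d i == a)) edge_weight t (c i) k.

Lemma last_weight_split n (E : rel 'I_n.+1) (c d : {ffun 'I_n -> 'I_N}) (k : 'I_N) :
  merge_coloring c = d -> k \in [:: a; b] ->
  last_weight t E c k = outer_weight E d * inner_weight E d c k.
Proof.
move=> cd kab; rewrite /last_weight (bigID (fun i => d i != a)) /=.
congr (_ * _); last by apply: eq_bigl => i; rewrite negbK.
by apply: eq_bigr => i /andP[_]; rewrite -cd ffunE => /edge_adjacent->.
Qed.

Lemma tau_outer_weight n (E : rel 'I_n.+1) d :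
  tau (outer_weight E d) = outer_weight E d.
Proof. by rewrite rmorph_prod; apply: eq_bigr => i _; rewrite tau_edge. Qed.

(* The two colors [a] and [b] alternate along each connected component of     *)
(* the graph induced on their vertices, which is a path.  As the vertices     *)
(* are added in increasing order, the pair of partial sums according to the   *)
(* color of the last such vertex is, up to an invariant factor, (X a, X b)    *)
(* or (1, t) depending on the parity of the length of the last path.          *)
Definition transfer_pair (u v : R) : Prop :=
  exists2 S, tau S = S &
    (u = S * X a /\ v = S * X b) \/ (u = S /\ v = S * t).

Lemma tau_transfer_pair u v : transfer_pair u v -> tau (u + v) = u + v.
Proof.
case=> S tauS [] [-> ->]; rewrite rmorphD !rmorphM /= tauS.
  by rewrite !tau_X tpermL tpermR addrC.
by rewrite tau_t.
Qed.

Lemma transfer_pair_scale C u v : tau C = C ->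
  transfer_pair u v -> transfer_pair (u * C) (v * C).
Proof.
move=> tauC [S tauS uv]; exists (S * C); first by rewrite rmorphM /= tauS tauC.
by case: uv => -[-> ->]; [left|right]; split; rewrite // mulrAC.
Qed.

(** The path grows by one vertex, whose color must differ from the previous one: [b] then [a] is a
    descent, [a] then [b] an ascent. The two shapes of pairs are interchanged. *)
Lemma transfer_pair_step C u v : tau C = C -> transfer_pair u v ->
  transfer_pair (X a * (C * v)) (X b * (C * (t * u))).
Proof.
move=> tauC [S tauS [] [-> ->]]; [exists (C * S * X a * X b)|exists (C * S * t)].
- by rewrite !rmorphM /= tauS tauC !tau_X tpermL tpermR mulrAC.
- by right; split; ring.
- by rewrite !rmorphM /= tauS tauC tau_t.
- by left; split; ring.
Qed.

Lemma fiber_sum_at_max_inner n (E : rel 'I_n.+1) (d : {ffun 'I_n -> 'I_N}) k :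
  k \in [:: a; b] ->
  fiber_sum_at E (ffun_rcons d a) ord_max k =
  X k * (outer_weight E d * \sum_(c | merge_coloring c == d)
    coloring_weight t X (del_last E) c * inner_weight E d c k).
Proof.
move=> kab; rewrite fiber_sum_at_max; last first.
  by apply/eqP; rewrite merge_color_eqa; rewrite !inE in kab.
congr (_ * _); rewrite mulr_sumr; apply: eq_bigr => c /eqP cd.
by rewrite (last_weight_split E cd kab) mulrCA.
Qed.

Lemma last_neighbour n (d : {ffun 'I_n -> 'I_N}) j : d j = a ->
  exists2 j0, d j0 = a & forall i : 'I_n, (j0 < i)%N -> d i != a.
Proof.
move=> /eqP dj; case: (@arg_maxnP _ j (fun i => d i == a) val dj) => j0 /eqP dj0 maxj0.
exists j0 => // i; rewrite ltnNge; apply: contra => /maxj0.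
exact.
Qed.

(** The claim on pairs strengthens the induction on vertices. A last vertex of a third color
    multiplies everything by an invariant; one colored [a] or [b] has zero, one, or at least two
    neighbours with these colors, and so starts a path, extends it, or makes the sum vanish. *)
Lemma fiber_sum_transfer n (E : rel 'I_n) (d : {ffun 'I_n -> 'I_N}) :
  interval_closed E ->
  tau (fiber_sum E d) = fiber_sum E d /\
  forall j : 'I_n, d j = a -> (forall i : 'I_n, (j < i)%N -> d i != a) ->
  transfer_pair (fiber_sum_at E d j a) (fiber_sum_at E d j b).
Proof.
elim: n E d => [|n IH] E d EI.
  split=> [|[]//]; rewrite rmorph_sum; apply: eq_bigr => c _.
  by rewrite /coloring_weight big_ord0 rmorph1.
have {IH} IH d' := IH _ d' (del_last_closed EI).
rewrite -(ffun_rcons_restrict d).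
move: [ffun i => _] (d ord_max) => {}d l; have [IHsum IHpair] := IH d.
case: (eqVneq l a) => [->|la]; last first.
  pose C := X l * last_weight t E d l.
  (* A merged coloring never takes the value [b]: the fiber is empty and the pair is [(0, 0)]. *)
  have [lb|lb] := eqVneq l b.
    have pred0l : (fun k => merge_color k == l) =1 pred0 by move=> k; rewrite lb merge_color_neq.
    split=> [|j]; first by rewrite fiber_sum_rcons big1 ?rmorph0 // => c _; rewrite big_pred0.
    case: (unliftP ord_max j) => [i|] -> => [_ _|]; last first.
      by rewrite ffun_rcons_max => /eqP; rewrite (negPf la).
    rewrite !fiber_sum_at_lift !big1 => [|c _|c _]; rewrite ?big_pred0 //.
    by exists 0; rewrite ?rmorph0 //; left; rewrite !mul0r.
  have tauC : tau C = C.
    rewrite rmorphM /= tau_X tpermD 1?eq_sym // rmorph_prod; congr (_ * _).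
    by apply: eq_bigr => i _; rewrite tau_edge.
  have inner c : merge_coloring c = d ->
      \sum_(k | merge_color k == l) coloring_weight t X (del_last E) c *
        (X k * last_weight t E c k) = coloring_weight t X (del_last E) c * C.
    move=> cd; rewrite (big_pred1 l) => [|k]; last exact: merge_color_eq.
    congr (_ * (_ * _)); apply: eq_bigr => i _.
    by rewrite edge_merge // -cd ffunE.
  split=> [|j].
    rewrite fiber_sum_rcons (eq_bigr _ (fun c cd => inner c (eqP cd))).
    by rewrite -mulr_suml rmorphM /= IHsum tauC.
  case: (unliftP ord_max j) => [i|] ->; last first.
    by rewrite ffun_rcons_max => /eqP; rewrite (negPf la).
  rewrite ffun_rcons_lift => di maxi; rewrite !fiber_sum_at_lift.
  rewrite (eq_bigr _ (fun c cd => inner c (eqP (proj1 (andP cd))))) -mulr_suml.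
  rewrite (eq_bigr _ (fun c cd => inner c (eqP (proj1 (andP cd))))) -mulr_suml.
  apply: transfer_pair_scale => //; apply: IHpair => // i' ii'.
  by rewrite -(ffun_rcons_lift d l) maxi // !lift_max.
(* The last vertex is now the last one colored [a] or [b], so only its pair matters, and the fiber
   sum is the sum of that pair. *)
suff pair_max : transfer_pair (fiber_sum_at E (ffun_rcons d a) ord_max a)
                              (fiber_sum_at E (ffun_rcons d a) ord_max b).
  split=> [|j dj maxj].
    rewrite /fiber_sum (fiber_sum_split _ (ffun_rcons_max d a)).
    exact: tau_transfer_pair.
  case: (unliftP ord_max j) maxj dj => [i|] -> //.
  by move/(_ ord_max); rewrite lift_max ltn_ord ffun_rcons_max eqxx => /(_ isT).
rewrite !fiber_sum_at_max_inner ?inE ?eqxx ?orbT //.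
have [i /andP[Ei /eqP di]|noN] :=
  pickP (fun i => E (lift ord_max i) ord_max && (d i == a)); last first.
  (* A new path starts here; the invariant factor is the fiber sum of the smaller graph times the
     outer weight. *)
  exists (outer_weight E d * fiber_sum (del_last E) d).
    by rewrite rmorphM /= IHsum tau_outer_weight.
  by left; split; rewrite mulrC; congr (_ * _ * _); apply: eq_bigr => c _;
    rewrite /inner_weight big_pred0 ?mulr1.
have [j dj maxj] := last_neighbour di.
have ij : (i <= j)%N by rewrite leqNgt; apply/negP => /maxj; rewrite di eqxx.
(* The interval condition passes from the neighbour [i] to [j], the last earlier vertex colored [a]
   or [b]. *)
have Ej : E (lift ord_max j) ord_max.
  by apply: (EI _ _ _ Ei); rewrite ?lift_max ?ltn_ord.
(* Two such neighbours are adjacent to each other; with the last vertex they form a triangle, which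
   two colors cannot color properly. *)
have [j2 /andP[/andP[E2 /eqP d2] j2j]|only_j] :=
  pickP (fun i => E (lift ord_max i) ord_max && (d i == a) && (i != j)).
  have lt_j2j : (j2 < j)%N.
    by rewrite ltn_neqAle val_eqE j2j leqNgt; apply/negP => /maxj; rewrite d2 eqxx.
  have Ej2j : del_last E j2 j.
    by apply: (EI _ _ _ E2); rewrite ?lift_max ?ltn_ord // ltnW.
  have col c i' : merge_coloring c = d -> d i' = a -> (c i' == a) || (c i' == b).
    by move=> <-; rewrite ffunE -merge_color_eqa => ->.
  rewrite !big1 => [|c /eqP cd|c /eqP cd].
  - by exists 0; rewrite ?rmorph0 //; left; rewrite !(mulr0, mul0r).
  - have [e|ne] := eqVneq (c j2) (c j).
      by rewrite (coloring_weight_eq0 _ _ lt_j2j) ?mul0r.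
    have [i' [Ei' di' ci']] : exists i',
        [/\ E (lift ord_max i') ord_max, d i' = a & c i' = b].
      have [cj|cj] := eqVneq (c j) b; first by exists j.
      have cja := col _ _ cd dj; rewrite (negPf cj) orbF in cja.
      exists j2; split=> //; apply/eqP; move: ne (col _ _ cd d2).
      by rewrite (eqP cja) => /negPf->.
    rewrite /inner_weight (bigD1 i') ?Ei' ?di' ?eqxx //= ci'.
    by rewrite /edge_weight eqxx mul0r mulr0.
  - have [e|ne] := eqVneq (c j2) (c j).
      by rewrite (coloring_weight_eq0 _ _ lt_j2j) ?mul0r.
    have [i' [Ei' di' ci']] : exists i',
        [/\ E (lift ord_max i') ord_max, d i' = a & c i' = a].
      have [cj|cj] := eqVneq (c j) a; first by exists j.
      have cjb := col _ _ cd dj; rewrite (negPf cj) /= in cjb.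
      exists j2; split=> //; apply/eqP; move: ne (col _ _ cd d2).
      by rewrite (eqP cjb) => /negPf->; rewrite orbF.
    rewrite /inner_weight (bigD1 i') ?Ei' ?di' ?eqxx //= ci'.
    by rewrite /edge_weight eqxx mul0r mulr0.
have innerE c k : inner_weight E d c k = edge_weight t (c j) k.
  rewrite /inner_weight (big_pred1 j) // => i' /=.
  case: (eqVneq i' j) => [->|i'j]; first by rewrite Ej dj eqxx.
  by have := only_j i'; rewrite i'j andbT.
rewrite !(fiber_sum_split _ dj).
have sum_at (k k' : 'I_N) : \sum_(c | (merge_coloring c == d) && (c j == k))
    coloring_weight t X (del_last E) c * inner_weight E d c k' =
    edge_weight t k k' * fiber_sum_at (del_last E) d j k.
  rewrite mulr_sumr; apply: eq_bigr => c /andP[_ /eqP cj].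
  by rewrite innerE cj mulrC.
(* Equal colors contribute 0; what remains is the pair at [j] with its entries crossed, with weights
   1 and [t]. *)
rewrite !sum_at /edge_weight !eqxx !mul0r ab (gtn_eqF (ltnSn a)) (ltn_eqF (ltnSn a)).
rewrite ltnSn ltnNge leqnSn /= add0r addr0 mul1r.
by apply: transfer_pair_step (IHpair _ _ _) => //; rewrite tau_outer_weight.
Qed.

Lemma coloring_sum_tau n (E : rel 'I_n) :
  interval_closed E -> tau (coloring_sum t X E) = coloring_sum t X E.
Proof.
move=> EI; rewrite /coloring_sum.
rewrite (partition_big (@merge_coloring n) xpredT) //= rmorph_sum.
by apply: eq_bigr => d _; have [] := fiber_sum_transfer d EI.
Qed.
End AdjacentColors.

(** * The chromatic family is a symmetric function *)

(** With [k = j - 1], the transposition of [i] and [j] is that of [i] and [k] conjugated by that of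
    [k] and [j]. *)
Lemma issym_adjacent (R : nzRingType) N (p : {mpoly R[N]}) :
  (forall a b : 'I_N, b = a.+1 :> nat -> msym (tperm a b) p = p) ->
  p \is symmetric.
Proof.
move=> adj; suff tpermp i j : msym (tperm i j) p = p.
  apply/issymP => s; have [ts -> _] := prod_tpermP s.
  elim: ts => [|ij ts IH]; first by rewrite big_nil msym1m.
  by rewrite big_cons msymMm tpermp.
wlog ij : i j / (i < j)%N => [IH|].
  case: (ltngtP i j) => [|ji|/val_inj->]; first exact: IH.
    by rewrite tpermC IH.
  by rewrite tperm1 msym1m.
have [m] := ubnP j; elim: m j ij => // m IH j ij; rewrite ltnS => jm.
have [/eqP e|ne] := boolP (j == i.+1 :> nat); first exact: adj.
have j_gt0 : (0 < j)%N by apply: leq_ltn_trans ij.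
have lt_ik : (i < j.-1)%N.
  by rewrite -ltnS prednK // ltn_neqAle [i.+1 == j]eq_sym ne.
have kN : (j.-1 < N)%N by rewrite (leq_ltn_trans (leq_pred _)).
pose k := Ordinal kN.
have jk : j = k.+1 :> nat by rewrite /= prednK.
have -> : tperm i j = (tperm i k ^ tperm k j)%g.
  rewrite tpermJ tpermL tpermD // -val_eqE /= ?(gtn_eqF lt_ik) //.
  by rewrite gtn_eqF.
have pk : msym (tperm k j) p = p by apply: adj.
rewrite /conjg !msymMm tpermV pk IH //.
by rewrite -ltnS -jk.
Qed.

Lemma msymXU (R : nzRingType) N (s : 'S_N) k :
  msym s 'X_k = 'X_(s k) :> {mpoly R[N]}.
Proof.
rewrite msymX; congr mpolyX; apply/mnmP => i; rewrite mnmE !mnm1E.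
by rewrite -{1}(permK s k) (inj_eq perm_inj).
Qed.

(** Colorings that use the last color vanish; the others come from one color fewer, in the same
    order. *)
Lemma coloring_sum_kill (R : comNzRingType) (t : R) n N (E : rel 'I_n)
    (X : 'I_N.+1 -> R) :
  X ord_max = 0 ->
  coloring_sum t X E = coloring_sum t (fun k => X (lift ord_max k)) E.
Proof.
move=> X0; pose h (c : {ffun 'I_n -> 'I_N}) := [ffun i => lift ord_max (c i)].
have h_inj : injective h.
  move=> c c' /ffunP e; apply/ffunP => i; have := e i; rewrite !ffunE.
  exact: lift_inj.
rewrite /coloring_sum (bigID (mem (h @: setT))) /= addrC big1 ?add0r => [|c].
  rewrite (big_imset _ (in2W h_inj)) /=; apply: eq_big => [c|c _].
    by rewrite inE.
  apply: eq_bigr => j _; rewrite ffunE; congr (_ * _); apply: eq_bigr => i _.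
  by rewrite !ffunE !lift_max.
have [/existsP[i /eqP ci] _|no_max /negP[]] := boolP [exists i, c i == ord_max].
  by rewrite /coloring_weight (bigD1 i) //= ci X0 !mul0r.
have /fin_all_exists[c' cE] i : exists k, c i = lift ord_max k.
  case: (unliftP ord_max (c i)) => [k ->|ci]; first by exists k.
  by case/existsP: no_max; exists i; apply/eqP.
by apply/imsetP; exists (finfun c') => //; apply/ffunP => i; rewrite !ffunE cE.
Qed.

Lemma chromatic_family_symfun (R : comNzRingType) (t : R) n (E : rel 'I_n) :
  dyck_graph E -> is_symfun (chromatic_family t E).
Proof.
case=> -[Esym Eirr] EI; split=> [N|N|].
- rewrite chromatic_familyE //; apply: issym_adjacent => a b ab.
  by apply: (coloring_sum_tau ab) => // [|k]; [exact: mmapC|exact: msymXU].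
- rewrite !chromatic_familyE // /kill_last.
  rewrite (coloring_sum_morph (comp_mpoly _)) /= comp_mpolyC coloring_sum_kill.
    apply: eq_coloring_sum => k.
    by rewrite comp_mpolyXU -tnth_nth tnth_mktuple liftK.
  by rewrite comp_mpolyXU -tnth_nth tnth_mktuple unlift_none.
- exists n.+1 => N; rewrite /chromatic_family.
  apply: leq_trans (mmeasure_sum _ _ _ _) _; apply/bigmax_leqP => c _.
  apply: leq_trans (msizeZ_le _ _) _.
  rewrite -(big_morph _ (@mpolyXD _ _) (@mpolyX0 _ _)) msizeX mdeg_sum.
  by under eq_bigr do rewrite mdeg1; rewrite sum1_card card_ord.
Qed.

(** * Principal specialization of the coloring sum *)

(* With psi k = t ^ (m - k) * prod_i (if c i < k then t else 1), the k-th term *)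
(* times t - 1 is psi k - psi (k + 1), also when k is a forbidden color.       *)
Lemma sum_free_colors (R : comNzRingType) (t : R) m (I : finType) (P : pred I)
    (c : I -> 'I_m) : {in P &, injective c} ->
  (\sum_(k < m) t ^+ (m.-1 - k) * \prod_(i | P i) edge_weight t (c i) k) * (t - 1)
  = t ^+ m - t ^+ #|P|.
Proof.
move=> c_inj; pose below (k : nat) := \prod_(i | P i) (if (c i < k)%N then t else 1).
pose psi (k : nat) := - (t ^+ (m - k) * below k).
rewrite mulr_suml (eq_bigr (fun k : 'I_m => psi k.+1 - psi k)) => [|k _].
  rewrite -(big_mkord xpredT (fun k => psi k.+1 - psi k)) telescope_sumr //.
  rewrite /psi /below subnn subn0 expr0 mul1r opprK addrC [X in _ * X]big1 // mulr1.
  rewrite -prodr_const; congr (_ - _); apply: eq_big => // i _.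
  by rewrite ltn_ord.
have m_gt0 : (0 < m)%N by apply: leq_ltn_trans (ltn_ord k).
have -> : psi k = - (t * t ^+ (m.-1 - k) * below k).
  by rewrite /psi -exprS -subSn ?prednK // -ltnS prednK.
have -> : psi k.+1 = - (t ^+ (m.-1 - k) * below k.+1).
  by rewrite /psi -[m.-1]subn1 -subnDA add1n.
have [i0 /andP[Pi0 /eqP ci0]|no_k] := pickP (fun i => P i && (c i == k)).
  have c_neq i : P i && (i != i0) -> (c i == k :> nat) = false.
    case/andP=> Pi; rewrite val_eqE -ci0; apply: contraNF => /eqP.
    by move/c_inj->.
  rewrite (bigD1 i0) //= ci0 {1}/edge_weight eqxx mul0r mulr0 mul0r.
  rewrite /below !(bigD1 i0 Pi0) /= ci0 ltnn ltnSn.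
  rewrite (eq_bigr (fun i => if (c i < k)%N then t else 1)); last first.
    by move=> i /c_neq ik; rewrite ltnS leq_eqVlt ik.
  by ring.
have c_neq i : P i -> (c i == k :> nat) = false.
  by move=> Pi; have := no_k i; rewrite Pi.
rewrite /below (eq_bigr (fun i => if (c i < k)%N then t else 1)); last first.
  by move=> i /c_neq; rewrite /edge_weight => ->.
rewrite [X in _ = - (_ * X) - _](eq_bigr (fun i => if (c i < k)%N then t else 1)); last first.
  by move=> i /c_neq ik; rewrite ltnS leq_eqVlt ik.
by ring.
Qed.

Lemma left_degree_max n (E : rel 'I_n.+1) :
  left_degree E ord_max = #|[pred i : 'I_n | E (lift ord_max i) ord_max]|.
Proof.
rewrite -cardsE /left_degree -!sum1dep_card big_mkcond big_ord_recr [RHS]big_mkcond.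
rewrite ltnn /= addn0; apply: eq_bigr => i _.
by rewrite ltn_ord widen_ord_lift.
Qed.

Lemma left_degree_lift n (E : rel 'I_n.+1) j :
  left_degree E (lift ord_max j) = left_degree (del_last E) j.
Proof.
rewrite /left_degree -!sum1dep_card big_mkcond big_ord_recr [RHS]big_mkcond.
rewrite lift_max [(ord_max < j)%N]ltnNge (ltnW (ltn_ord j)) /= addn0.
by apply: eq_bigr => i _; rewrite widen_ord_lift.
Qed.

(** With the colors of the other vertices fixed, the sum over the last color is an instance of
    [sum_free_colors]. *)
Lemma coloring_sum_principal (R : comNzRingType) (t : R) m n (E : rel 'I_n) :
  interval_closed E ->
  (t - 1) ^+ n * coloring_sum t (fun k : 'I_m => t ^+ (m.-1 - k)) E =
  \prod_(j < n) (t ^+ m - t ^+ left_degree E j).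
Proof.
elim: n E => [|n IH] E EI.
  rewrite big_ord0 mul1r /coloring_sum (eq_bigr (fun=> 1)) => [|c _].
    by rewrite sumr_const card_ffun !card_ord expn0.
  by rewrite /coloring_weight big_ord0.
rewrite prod_ord_rcons left_degree_max.
under eq_bigr do rewrite left_degree_lift.
rewrite -IH; last exact: del_last_closed.
rewrite exprSr -!mulrA; congr (_ * _).
rewrite /coloring_sum big_ffun_rcons mulr_sumr mulr_suml; apply: eq_bigr => c _.
under eq_bigr do rewrite coloring_weight_rcons.
rewrite -mulr_sumr mulrCA.
have [c_inj|] := boolP [forall i, forall j,
    [&& E (lift ord_max i) ord_max, E (lift ord_max j) ord_max & c i == c j]
      ==> (i == j)].
  congr (_ * _); rewrite mulrC; apply: sum_free_colors => i j Ei Ej cij.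
  apply/eqP; move/forallP/(_ i)/forallP/(_ j)/implyP: c_inj; apply.
  by apply/and3P; split=> //; apply/eqP.
(* Two neighbours of the last vertex share a color; being adjacent, they make both sides 0. *)
rewrite negb_forall => /existsP[i]; rewrite negb_forall => /existsP[j].
rewrite negb_imply => /andP[/and3P[Ei Ej /eqP cij] ij].
wlog lt_ij : i j Ei Ej cij ij / (i < j)%N => [IHij|].
  case: (ltngtP i j) => [|ji|/val_inj eij]; first exact: IHij.
    by apply: (IHij j i); rewrite 1?eq_sym.
  by rewrite eij eqxx in ij.
have Eij : del_last E i j by apply: (EI _ _ _ Ei); rewrite ?lift_max ?ltn_ord // ltnW.
by rewrite (coloring_weight_eq0 _ _ lt_ij Eij cij) !mul0r.
Qed.

(** * Power sums generate the symmetric functions *)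

(** For positive exponents, the augmented monomial symmetric function of [alpha]. *)
Definition injective_sum (R : comNzRingType) l (alpha : 'I_l -> nat) : xfamily R :=
  fun N => \sum_(g : {ffun 'I_l -> 'I_N} | injectiveb g)
             \prod_(i < l) 'X_(g i) ^+ alpha i.

Lemma injective_ffun_rcons l (T : finType) (g : {ffun 'I_l -> T}) k :
  injectiveb (ffun_rcons g k) = injectiveb g && (k \notin codom g).
Proof.
apply/injectiveP/andP => [g_inj|[/injectiveP g_inj k_g] i j].
  split; first apply/injectiveP => i j gij.
    by apply: (@lift_inj _ ord_max); apply: g_inj; rewrite !ffun_rcons_lift.
  apply/codomP => -[i kE]; have /eqP := neq_lift ord_max i; apply.
  by apply: g_inj; rewrite ffun_rcons_max ffun_rcons_lift.
case: (unliftP ord_max i) => [i'|] ->; case: (unliftP ord_max j) => [j'|] -> //;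
  rewrite ?ffun_rcons_lift ?ffun_rcons_max.
- by move/g_inj->.
- by move=> e; case/codomP: k_g; exists i'.
- by move=> e; case/codomP: k_g; exists j'.
Qed.

(* The color of the last index is free, minus the colors of the other ones.   *)
Lemma injective_sum_rec (R : comNzRingType) l (alpha : 'I_l.+1 -> nat) N :
  injective_sum R alpha N =
  powersum_family R (alpha ord_max) N *
    injective_sum R (fun j => alpha (lift ord_max j)) N -
  \sum_(i < l) injective_sum R
    (fun j => alpha (lift ord_max j) + (j == i) * alpha ord_max)%N N.
Proof.
rewrite {1 2}/injective_sum big_ffun_rcons mulr_sumr exchange_big /= -sumrB.
rewrite [RHS]big_mkcond /=; apply: eq_bigr => g _.
under eq_bigl do rewrite injective_ffun_rcons.
case: ifP => /= [/injectiveP g_inj|_]; last by rewrite big_pred0.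
have prod_shift i : \prod_(j < l) 'X_(g j) ^+ (alpha (lift ord_max j) +
      (j == i) * alpha ord_max) =
    'X_(g i) ^+ alpha ord_max * \prod_(j < l) 'X_(g j) ^+ alpha (lift ord_max j)
    :> {mpoly R[N]}.
  under eq_bigr do rewrite exprD.
  rewrite big_split /= mulrC; congr (_ * _); rewrite (bigD1 i) //= eqxx mul1n.
  by rewrite big1 ?mulr1 // => j /negPf->; rewrite mul0n expr0.
under [X in _ = _ - X]eq_bigr do rewrite prod_shift.
rewrite -mulr_suml -mulrBl.
rewrite (_ : _ - _ = \sum_(k | k \notin codom g) 'X_k ^+ alpha ord_max).
  rewrite mulr_suml; apply: eq_bigr => k _; rewrite prod_ord_rcons mulrC.
  rewrite ffun_rcons_max; congr (_ * _); apply: eq_bigr => j _.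
  by rewrite ffun_rcons_lift.
apply/eqP; rewrite subr_eq addrC /powersum_family.
rewrite (bigID (mem (codom g))) /=; apply/eqP; congr (_ + _).
rewrite (eq_bigl (mem (g @: setT))) => [|k].
  by rewrite (big_imset _ (in2W g_inj)); apply: eq_bigl => i; rewrite inE.
by apply/codomP/imsetP => [[i ->]|[i _ ->]]; exists i.
Qed.

Lemma symfun_val_sum (R : comNzRingType) (I : Type) (r : seq I) (Q : pred I)
    (F : I -> symfun R) N :
  symfun_val (\sum_(i <- r | Q i) F i) N = \sum_(i <- r | Q i) symfun_val (F i) N.
Proof. exact: (big_morph (fun f : symfun R => symfun_val f N)). Qed.

Section InjectiveSubstitution.
Variable R : comNzRingType.

Lemma mcoeff_kill_last N (p : {mpoly R[N.+1]}) (m : 'X_{1..N.+1}) :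
  m ord_max = 0%N ->
  (kill_last p)@_[multinom m (lift ord_max i) | i < N] = p@_m.
Proof.
move=> m0; rewrite [in RHS](mpolyE p) /kill_last comp_mpolyEX !raddf_sum /=.
apply: eq_bigr => m' _; rewrite !mcoeffZ comp_mpolyX prod_ord_rcons.
congr (_ * _); rewrite tnth_mktuple unlift_none expr0n mcoeffX.
under eq_bigr do rewrite tnth_mktuple liftK.
have -> : \prod_(i < N) 'X_i ^+ m' (lift ord_max i) =
    'X_[R, [multinom m' (lift ord_max i) | i < N]].
  by rewrite mpolyXE_id; apply: eq_bigr => i _; rewrite mnmE.
have [m'0|m'0] := eqVneq (m' ord_max) 0%N; last first.
  rewrite mulr0 mcoeff0; case: eqP => // e.
  by rewrite e m0 eqxx in m'0.
rewrite mulr1 mcoeffX; congr (nat_of_bool _)%:R.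
apply/eqP/eqP => [/mnmP e|-> //]; apply/mnmP => i.
case: (unliftP ord_max i) => [j|] ->; last by rewrite m0.
by have := e j; rewrite !mnmE.
Qed.

(** If a monomial missed a variable, symmetry would make that variable the last one, and the
    monomial would survive in [f] with one variable fewer, which is 0. *)
Lemma msupp_full N (f : xfamily R) (m : 'X_{1..N}) :
  is_symfun f -> (forall N', (N' < N)%N -> f N' = 0) -> m \in msupp (f N) ->
  forall i, (0 < m i)%N.
Proof.
case=> fS fK _; case: N m => [|N] m f0 fm i; first by case: i.
rewrite lt0n; apply/eqP => mi.
have := fm; rewrite -(issym_msupp (tperm i ord_max) m (fS _)) mcoeff_msupp.
rewrite -mcoeff_kill_last; last by rewrite mnmE tpermR.
by rewrite fK f0 // mcoeff0 eqxx.
Qed.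

Lemma leq_mdeg N (m : 'X_{1..N}) : (forall i, 0 < m i)%N -> (N <= mdeg m)%N.
Proof.
move=> m_gt0; rewrite mdegE -[X in (X <= _)%N](card_ord N) -sum1_card.
by apply: leq_sum.
Qed.

(** [msize] is the degree plus one. In the first [N >= d] variables where [f] is nonzero, each
    monomial would involve all of them and have degree at least [d]. *)
Lemma symfun_eq0 d (f : symfun R) :
  (forall N, msize (symfun_val f N) <= d)%N ->
  (forall N, (N < d)%N -> symfun_val f N = 0) -> f = 0.
Proof.
move=> fd f0; apply: val_inj; apply: xfamilyP => N /=.
have [n] := ubnP N; elim: n N => // n IH N; rewrite ltnS => Nn.
have [/f0//|dN] := ltnP N d.
apply: msuppnil0; case fE: (msupp _) => [//|m s].
have fm : m \in msupp (symfun_val f N) by rewrite fE mem_head.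
have /leq_mdeg m_ge : forall i, (0 < m i)%N.
  apply: (msupp_full _ _ fm); first by apply/symfun_predP; case: (f).
  by move=> N' N'N; apply: IH; apply: leq_trans Nn.
have := leq_trans (msize_mdeg_lt fm) (fd N).
by rewrite ltnNge (leq_trans dN).
Qed.

Definition injective_subst l (p : {mpoly R[l]}) : xfamily R :=
  fun N => \sum_(g : {ffun 'I_l -> 'I_N} | injectiveb g)
             (p \mPo [tuple 'X_(g i) | i < l]).

Lemma injective_substE l (p : {mpoly R[l]}) N :
  injective_subst p N = \sum_(m <- msupp p) p@_m *: injective_sum R m N.
Proof.
rewrite /injective_subst; under eq_bigr do rewrite comp_mpolyEX.
rewrite exchange_big; apply: eq_bigr => m _; rewrite -scaler_sumr; congr (_ *: _).
apply: eq_bigr => g _; rewrite comp_mpolyX.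
by under eq_bigr do rewrite tnth_mktuple.
Qed.

Lemma injective_subst0 l (p : {mpoly R[l]}) N :
  (N < l)%N -> injective_subst p N = 0.
Proof.
move=> Nl; rewrite /injective_subst big_pred0 // => g; apply/injectiveP => /leq_card.
by rewrite !card_ord leqNgt Nl.
Qed.

(** The injections are permutations here. Their number is invertible in characteristic 0, so [p] can
    be recovered. *)
Lemma injective_subst_id l (p : {mpoly R[l]}) : p \is symmetric ->
  injective_subst p l =
  #|[pred g : {ffun 'I_l -> 'I_l} | injectiveb g]|%:R *: p.
Proof.
move=> /issymP pS; rewrite scaler_nat -sumr_const; apply: eq_bigr => g.
move=> /injectiveP g_inj; rewrite -[RHS](pS (perm g_inj)) /msym /comp_mpoly.
apply: eq_bigr => m _; congr (_ * _); apply: mmap1_eq => i.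
by rewrite tnth_mktuple permE.
Qed.

Lemma msize_injective_subst l (p : {mpoly R[l]}) N :
  (msize (injective_subst p N) <= msize p)%N.
Proof.
apply: leq_trans (mmeasure_sum _ _ _ _) _; apply/bigmax_leqP => g _.
rewrite comp_mpolyEX; apply: leq_trans (mmeasure_sum _ _ _ _) _.
rewrite big_seq; apply/bigmax_leqP_seq => m mp _.
apply: leq_trans (msizeZ_le _ _) _; rewrite comp_mpolyX.
under eq_bigr do rewrite tnth_mktuple mpolyXn.
rewrite -(big_morph _ (@mpolyXD _ _) (@mpolyX0 _ _)) msizeX mdeg_sum.
under eq_bigr do rewrite mdegMn mdeg1 mul1n.
by rewrite -mdegE msize_mdeg_lt.
Qed.

End InjectiveSubstitution.

Section PowerSumGeneration.
Variables (R : fieldType) (P : symfun R -> Prop).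
Hypothesis char0 : [pchar R] =i pred0.
Hypothesis P1 : P 1.
Hypothesis Pp : forall k, (0 < k)%N -> P (powersum R k).
Hypothesis PD : forall f g, P f -> P g -> P (f + g).
Hypothesis PM : forall f g, P f -> P g -> P (f * g).
Hypothesis PZ : forall a f, P f -> P (a *: f).

Let P0 : P 0. Proof. by rewrite -(scale0r 1); apply: PZ. Qed.

(** Induction on the length by [injective_sum_rec]; exponents only get added, so they stay positive
    and [p_0] never appears. *)
Lemma injective_sum_generated l (alpha : 'I_l -> nat) :
  (forall i, 0 < alpha i)%N ->
  exists2 f, P f & symfun_val f = injective_sum R alpha.
Proof.
elim: l alpha => [|l IH] alpha alpha_gt0.
  exists 1 => //; apply: xfamilyP => N; rewrite /injective_sum.
  rewrite (big_pred1 [ffun i : 'I_0 => match i with Ordinal _ h => False_rect _ (notF h) end]).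
    by rewrite big_ord0.
  move=> g /=; have -> : g = [ffun i : 'I_0 => match i with Ordinal _ h => False_rect _ (notF h) end].
    by apply/ffunP => -[].
  by rewrite eqxx; apply/injectiveP => -[].
have /IH[f0 Pf0 f0E] : forall i, (0 < alpha (lift ord_max i))%N by [].
have /fin_all_exists2[F PF FE] i : exists2 f, P f & symfun_val f =
    injective_sum R (fun j => alpha (lift ord_max j) + (j == i) * alpha ord_max)%N.
  by apply: IH => j; rewrite addn_gt0 alpha_gt0.
exists (powersum R (alpha ord_max) * f0 + (-1) *: \sum_i F i).
  by apply: PD; [apply: PM => //; exact: Pp|apply: PZ; elim/big_ind: _].
apply: xfamilyP => N; rewrite injective_sum_rec -f0E -powersumE // scaleN1r.
rewrite [X in _ = _ - X](eq_bigr (fun i => symfun_val (F i) N)) => [|i _].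
  by rewrite -symfun_val_sum.
by rewrite FE.
Qed.

(* If f vanishes in fewer than l variables, the part of f involving exactly   *)
(* l variables is a multiple of the sum of the injective substitutions into   *)
(* f(x_0, ..., x_(l-1)); subtracting it raises l, until l exceeds the degree. *)
Lemma symfun_ind f : P f.
Proof.
have [d fd] : exists d, forall N, (msize (symfun_val f N) <= d)%N.
  by have /symfun_predP[] := valP f.
suff low_vars k l g : (forall N, msize (symfun_val g N) <= d)%N -> (d <= l + k)%N ->
    (forall N, (N < l)%N -> symfun_val g N = 0) -> P g.
  exact: (low_vars d 0%N).
elim: k l g {f fd} => [|k IH] l f fd dlk f0.
  by rewrite (symfun_eq0 fd) // => N Nd; apply: f0; rewrite (leq_trans Nd) // -[l]addn0.
have fS := valP f; move/symfun_predP: fS => fS.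
have fl_pos m : m \in msupp (symfun_val f l) -> forall i, (0 < m i)%N.
  by apply: msupp_full.
have /choice[F FP] m : exists g, m \in msupp (symfun_val f l) ->
    P g /\ symfun_val g = injective_sum R m.
  case: (boolP (m \in msupp (symfun_val f l))) => [/fl_pos/injective_sum_generated[g]|_].
    by exists g.
  by exists 0.
pose h := \sum_(m <- msupp (symfun_val f l)) (symfun_val f l)@_m *: F m.
have Ph : P h.
  rewrite /h big_seq; elim/big_ind: _ => // m mf; apply: PZ.
  by have [] := FP m mf.
have hE N : symfun_val h N = injective_subst (symfun_val f l) N.
  rewrite injective_substE symfun_val_sum big_seq [RHS]big_seq.
  by apply: eq_bigr => m mf; have [_ <-] := FP m mf.
pose c : R := #|[pred g : {ffun 'I_l -> 'I_l} | injectiveb g]|%:R.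
have c_neq0 : c != 0.
  have /pcharf0P -> := char0; rewrite -lt0n; apply/card_gt0P; exists [ffun i => i].
  by rewrite inE; apply/injectiveP => i j; rewrite !ffunE.
rewrite -(subrK (c^-1 *: h) f); apply: PD; last exact: PZ.
have gE N : symfun_val (f - c^-1 *: h) N =
    symfun_val f N - c^-1 *: injective_subst (symfun_val f l) N by rewrite -hE.
apply: (IH l.+1) => [N||N]; rewrite ?gE.
- apply: leq_trans (msizeD_le _ _) _; rewrite geq_max fd msizeN.
  apply: leq_trans (msizeZ_le _ _) _.
  exact: leq_trans (msize_injective_subst _ _) (fd l).
- by rewrite addSnnS.
- rewrite ltnS leq_eqVlt => /orP[/eqP->|Nl].
    rewrite injective_subst_id; last by case: fS.
    by rewrite scalerA mulVf // scale1r subrr.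
  by rewrite injective_subst0 // f0 // scaler0 subr0.
Qed.

End PowerSumGeneration.

(** * Interpolation at the powers of [t] *)

Lemma Qqt_char0 : [pchar Qqt] =i pred0.
Proof.
apply/pcharf0P => k; rewrite -(rmorph_nat (@tofrac {poly {poly rat}})) tofrac_eq0.
by rewrite -!polyC_natr !polyC_eq0 Num.Theory.pnatr_eq0.
Qed.

Lemma tvar_exp_neq1 k : (0 < k)%N -> tvar ^+ k != 1.
Proof.
move=> k_gt0; rewrite /tvar -rmorphXn -(rmorph1 (@tofrac {poly {poly rat}})) tofrac_eq.
rewrite -rmorphXn -[1]polyC1 (inj_eq (@polyC_inj _)).
apply/eqP => /(congr1 (fun p : {poly rat} => size p)).
by rewrite size_polyXn size_poly1 => -[k0]; rewrite k0 in k_gt0.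
Qed.

Lemma tvar_neq0 : tvar != 0.
Proof. by rewrite tofrac_eq0 polyC_eq0 polyX_eq0. Qed.

Lemma tvar_exp_inj : injective (fun m => tvar ^+ m).
Proof.
move=> m m' /=; wlog mm' : m m' / (m <= m')%N => [IH e|].
  by case: (leqP m m') => [/IH->|/ltnW/IH->].
have tm_unit : tvar ^+ m != 0 by rewrite expf_neq0 // tvar_neq0.
rewrite -[in tvar ^+ m'](subnKC mm') exprD -[in LHS](mulr1 (tvar ^+ m)).
move/(mulfI tm_unit)/esym/eqP; apply: contraTeq => m_neq.
by rewrite tvar_exp_neq1 // subn_gt0 ltn_neqAle m_neq.
Qed.

(* At q = t^m the power sums take their values at (t^(m-1), ..., t, 1).        *)
Lemma symfun_specialization (phi : {lrmorphism symfun Qqt -> Qqt | *%R}) :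
  (forall k : nat, (0 < k)%N ->
     phi (powersum Qqt k) = (qvar ^+ k - 1) / (tvar ^+ k - 1)) ->
  forall f, exists h : {poly Qqt}, phi f = h.[qvar] /\
    forall m, (symfun_val f m).@[fun i => tvar ^+ (m.-1 - i)] = h.[tvar ^+ m].
Proof.
move=> phi_p; apply: symfun_ind; first exact: Qqt_char0.
- by exists 1; split=> [|m]; rewrite ?rmorph1 ?hornerE // meval1.
(* The witness is the prescribed value with [q] made an indeterminate; at [t^m] it is a geometric
   sum. *)
- move=> k k_gt0; exists ((tvar ^+ k - 1)^-1 *: ('X^k - 1)); split=> [|m].
    by rewrite phi_p // !hornerE mulrC.
  rewrite powersumE // rmorph_sum /= !hornerE.
  have tk1 : tvar ^+ k - 1 != 0 by rewrite subr_eq0 tvar_exp_neq1.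
  apply: (mulfI tk1); rewrite mulrA mulfV // mul1r.
  rewrite -exprM mulnC exprM [RHS]subrX1; congr (_ * _).
  rewrite (reindex_inj rev_ord_inj); apply: eq_bigr => i _ /=.
  rewrite rmorphXn /= mevalXU -!exprM mulnC; congr (_ ^+ (_ * _)).
  by rewrite /= -subn1 -subnDA add1n -subSn // subSS subKn // ltnW.
- move=> f g [h [phif fm]] [h' [phig gm]]; exists (h + h').
  by split=> [|m]; rewrite hornerD -?phif -?phig ?rmorphD // -fm -gm -mevalD.
- move=> f g [h [phif fm]] [h' [phig gm]]; exists (h * h').
  by split=> [|m]; rewrite hornerM -?phif -?phig ?rmorphM // -fm -gm -mevalM.
- move=> c f [h [phif fm]]; exists (c *: h).
  split=> [|m]; first by rewrite hornerZ -phif linearZ.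
  by rewrite hornerZ -fm -mevalZ.
Qed.

(** The powers of [t] are pairwise distinct, so a nonzero difference would have as many roots as its
    size, one more than its degree. *)
Lemma poly_eq_on_powers (p q : {poly Qqt}) :
  (forall m : nat, p.[tvar ^+ m] = q.[tvar ^+ m]) -> p = q.
Proof.
move=> pq; apply/eqP; rewrite -subr_eq0; apply/negPn/negP => d_neq0.
pose rs := [seq tvar ^+ m | m <- iota 0 (size (p - q))].
have rs_root : all (root (p - q)) rs.
  by apply/allP => _ /mapP[m _ ->]; rewrite /root hornerD hornerN pq subrr.
have rs_uniq : uniq rs by rewrite map_inj_uniq ?iota_uniq //; exact: tvar_exp_inj.
by have := max_poly_roots d_neq0 rs_root rs_uniq; rewrite size_map size_iota ltnn.
Qed.

Theorem theorem3p2 (n : nat) (E : rel 'I_n)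
    (phi : {lrmorphism symfun Qqt -> Qqt | *%R}) :
  dyck_graph E ->
  (forall k : nat, (0 < k)%N ->
     phi (powersum Qqt k) = (qvar ^+ k - 1) / (tvar ^+ k - 1)) ->
  (tvar - 1) ^+ n * phi (chromatic_symfun tvar E)
    = \prod_(j < n) (qvar - tvar ^+ left_degree E j).
Proof.
move=> E_dyck phi_p; have [[Esym Eirr] EI] := E_dyck.
have [h [-> hm]] := symfun_specialization phi_p (chromatic_symfun tvar E).
pose r := \prod_(j < n) ('X - (tvar ^+ left_degree E j)%:P).
(* The claim is the value at [q] of this identity of polynomials, which can be tested at the powers
   of [t]. *)
suff hr : (tvar - 1) ^+ n *: h = r.
  rewrite -hornerZ hr horner_prod; apply: eq_bigr => j _.
  by rewrite hornerXsubC.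
apply: poly_eq_on_powers => m; rewrite hornerZ -hm.
rewrite to_symfunK; last exact: chromatic_family_symfun.
rewrite chromatic_familyE // (coloring_sum_morph (meval _)) /= mevalC.
rewrite (eq_coloring_sum _ _ (mevalXU _)) coloring_sum_principal //.
by rewrite horner_prod; apply: eq_bigr => j _; rewrite hornerXsubC.
Qed.
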